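(* Let $\Lambda$ be a ring that is left hereditary, left perfect and right coherent. The reflector $\mathbf{r}:\Lambda\text{-}Mod\to\Lambda\text{-}Mod_{Pr}$ is left exact if and only if the ring $\Lambda$ is semisimple.
   Context: Rings are associative with identity; $\Lambda\text{-}Mod$ is the category of left unital $\Lambda$-modules and $\Lambda\text{-}Mod_{Pr}$ its full subcategory of projective modules. For a left hereditary, left perfect and right coherent ring, $\Lambda\text{-}Mod_{Pr}$ is a reflective subcategory of $\Lambda\text{-}Mod$ (known fact), i.e. the inclusion has a left adjoint $\mathbf{r}$, called the reflector. A ring is semisimple if all its left modules are semisimple (equivalently, projective). *)

(* Defs.v *)
From HB Require Import structures.
From mathcomp Require Import all_boot all_order all_algebra.
From mathcomp Require Import boolp.

Set Implicit Arguments.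
Unset Strict Implicit.
Unset Printing Implicit Defensive.

Import GRing.Theory.
Local Open Scope ring_scope.

Definition surjective (U V : Type) (f : U -> V) : Prop := forall y, exists x, f x = y.

(** [cardinality.finite_set] would force [T] below the universe of [lmodType R],
    hence exclude the objects of the category of modules. *)
Definition finite_type (T : Type) : Prop := exists n (e : 'I_n -> T), surjective e.

(** * Categories *)

Record category := Category {
  obj :> Type;
  hom : obj -> obj -> Type;
  idm : forall a, hom a a;
  comp : forall a b c, hom b c -> hom a b -> hom a c;
  comp_idl : forall a b (f : hom a b), comp (idm b) f = f;
  comp_idr : forall a b (f : hom a b), comp f (idm a) = f;
  comp_assoc : forall a b c d (h : hom c d) (g : hom b c) (f : hom a b),
    comp h (comp g f) = comp (comp h g) f }.

Arguments hom {c0} _ _ : rename.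
Arguments idm {c0} a : rename.
Arguments comp {c0 a b c} _ _ : rename.

Record functor (C D : category) := Functor {
  fobj :> C -> D;
  fmap : forall a b : C, hom a b -> hom (fobj a) (fobj b);
  fmap_id : forall a : C, fmap (idm a) = idm (fobj a);
  fmap_comp : forall (a b c : C) (g : hom b c) (f : hom a b),
    fmap (comp g f) = comp (fmap g) (fmap f) }.

Arguments fmap {C D} F {a b} _ : rename.

Section FunctorComposition.
Variables (C D E : category) (G : functor D E) (F : functor C D).

Let gf_map (a b : C) (f : hom a b) : hom (G (F a)) (G (F b)) := fmap G (fmap F f).

Lemma gf_map_id a : gf_map (idm a) = idm (G (F a)).
Proof. by rewrite /gf_map !fmap_id. Qed.

Lemma gf_map_comp (a b c : C) (g : hom b c) (f : hom a b) :
  gf_map (comp g f) = comp (gf_map g) (gf_map f).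
Proof. by rewrite /gf_map !fmap_comp. Qed.

Definition comp_functor : functor C E := Functor gf_map_id gf_map_comp.

End FunctorComposition.

(** * Limits and left exact functors *)

Record cone (J C : category) (D : functor J C) := Cone {
  apex : C;
  leg : forall j : J, hom apex (D j);
  leg_natural : forall (i j : J) (f : hom i j), comp (fmap D f) (leg i) = leg j }.

Definition is_limit (J C : category) (D : functor J C) (c : cone D) : Prop :=
  forall c' : cone D,
    exists! u : hom (apex c') (apex c), forall j, comp (leg c j) u = leg c' j.

Section ConeImage.
Variables (J C C' : category) (F : functor C C') (D : functor J C) (c : cone D).

Lemma map_leg_natural (i j : J) (f : hom i j) :
  comp (fmap (comp_functor F D) f) (fmap F (leg c i)) = fmap F (leg c j).
Proof. by rewrite -(leg_natural c f) fmap_comp. Qed.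

Definition map_cone : cone (comp_functor F D) := Cone map_leg_natural.

End ConeImage.

Definition finite_category (J : category) : Prop :=
  finite_type J /\ forall i j : J, finite_type (hom i j).

(** Preservation of the limits of all finite diagrams; the codomain is not
    required to be abelian. *)
Definition left_exact (C D : category) (F : functor C D) : Prop :=
  forall (J : category) (K : functor J C) (c : cone K),
    finite_category J -> is_limit c -> is_limit (map_cone F c).

(** * Adjunctions and full subcategories *)

Record adjunction (C D : category) (L : functor C D) (G : functor D C) := Adjunction {
  transpose : forall (a : C) (b : D), hom (L a) b -> hom a (G b);
  transpose_bij : forall (a : C) (b : D), bijective (@transpose a b);
  transpose_natl : forall (a a' : C) (b : D) (f : hom a' a) (g : hom (L a) b),
    transpose (comp g (fmap L f)) = comp (transpose g) f;
  transpose_natr : forall (a : C) (b b' : D) (h : hom b b') (g : hom (L a) b),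
    transpose (comp h g) = comp (fmap G h) (transpose g) }.

Section FullSubcategory.
Variables (C : category) (P : C -> Prop).

Definition full_subcategory : category :=
  @Category {a : C | P a} (fun a b => hom (sval a) (sval b))
    (fun a => idm (sval a)) (fun a b c => @comp C (sval a) (sval b) (sval c))
    (fun a b => @comp_idl C (sval a) (sval b))
    (fun a b => @comp_idr C (sval a) (sval b))
    (fun a b c d => @comp_assoc C (sval a) (sval b) (sval c) (sval d)).

Definition inclusion : functor full_subcategory C :=
  @Functor full_subcategory C (fun a => sval a) (fun a b f => f)
    (fun a => erefl) (fun a b c g f => erefl).

End FullSubcategory.

(** * Modules *)

Section ModuleCategory.
Variable R : pzRingType.

Lemma linear_ext (U V : lmodType R) (f g : {linear U -> V}) : f =1 g -> f = g.
Proof.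
case: f g => f [[fD] [fZ]] [g [[gD] [gZ]]] /= /funext fg.
case: _ / fg gD gZ => gD gZ.
by rewrite (Prop_irrelevance fD gD) (Prop_irrelevance fZ gZ).
Qed.

Definition module_category : category.
Proof.
refine (@Category (lmodType R) (fun U V => {linear U -> V}) (fun U => idfun)
  (fun U V W g f => g \o f) _ _ _).
- by move=> *; apply: linear_ext.
- by move=> *; apply: linear_ext.
- by move=> *; apply: linear_ext.
Defined.

Definition projective (P : lmodType R) : Prop :=
  forall (M N : lmodType R) (g : {linear M -> N}) (f : {linear P -> N}),
    surjective g -> exists h : {linear P -> M}, g \o h =1 f.

Definition projective_category : category := @full_subcategory module_category projective.

Definition projective_inclusion : functor projective_category module_category :=
  @inclusion module_category projective.

Definition submodule (V : lmodType R) (N : submodClosed V) : Type := {x : V | x \in N}.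

End ModuleCategory.

Section SubmoduleStructure.
Variables (R : pzRingType) (V : lmodType R) (N : submodClosed V).

HB.instance Definition _ := SubChoice.on (submodule N).
HB.instance Definition _ := [SubChoice_isSubLmodule of submodule N by <:].

End SubmoduleStructure.

Section Modules.
Variable R : pzRingType.
Implicit Types M P V : lmodType R.

Definition superfluous V (K : {pred V}) : Prop :=
  forall L : submodClosed V,
    (forall x, exists k l, [/\ k \in K, l \in L & x = k + l]) -> forall x, x \in L.

(** [p x == 0] is decidable in an [lmodType], so the kernel is a boolean predicate. *)
Definition projective_cover P M (p : {linear P -> M}) : Prop :=
  [/\ projective P, surjective p & superfluous [pred x | p x == 0]].

Definition finitely_generated M : Prop :=
  exists n (p : {linear 'rV[R]_n -> M}), surjective p.

Definition finitely_presented M : Prop :=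
  exists m n (q : {linear 'rV[R]_m -> 'rV[R]_n}) (p : {linear 'rV[R]_n -> M}),
    surjective p /\ forall x, p x = 0 <-> exists y, q y = x.

Definition semisimple_module M : Prop :=
  forall N : submodClosed M, exists N' : submodClosed M,
    (forall x, x \in N -> x \in N' -> x = 0) /\
    (forall x, exists y z, [/\ y \in N, z \in N' & x = y + z]).

End Modules.

(** * Rings *)

Section Rings.
Variable R : pzRingType.

Definition left_hereditary : Prop :=
  forall I : submodClosed R^o, projective (submodule I).

Definition left_perfect : Prop :=
  forall M : lmodType R, exists (P : lmodType R) (p : {linear P -> M}), projective_cover p.

Definition left_coherent : Prop :=
  forall I : submodClosed R^o,
    finitely_generated (submodule I) -> finitely_presented (submodule I).

Definition semisimple_ring : Prop := forall M : lmodType R, semisimple_module M.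

End Rings.

(** Right [R]-modules are left modules over the converse ring [R^c]. *)
Definition right_coherent (R : pzRingType) : Prop := left_coherent R^c.

(* Main.v *)
From HB Require Import structures.
Require Import Defs.
From mathcomp Require Import all_boot all_algebra.
From mathcomp Require Import boolp classical_sets functions.
Import Defs.

(** Suppose that the reflector is left exact and let [I] be a left ideal.
    It preserves the equalizer [I] of [p, 0 : R -> R / I], and the unit of the
    adjunction is invertible at the projective modules [I] and [R], so the unit
    at [R / I] is injective.  Hence [I] is the annihilator of an element of a
    projective module, and the dual basis lemma turns it into the annihilator of
    finitely many scalars.  As principal left ideals are projective, such an
    annihilator is generated by an idempotent; when this holds for all left
    ideals, Zorn's lemma makes every module semisimple.

    Conversely, over a semisimple ring all modules are projective, so the unit
    of the adjunction is an isomorphism and the reflector preserves all limits. *)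

Set Implicit Arguments.
Unset Strict Implicit.
Unset Printing Implicit Defensive.

Import GRing.Theory.
Local Open Scope ring_scope.
Local Open Scope quotient_scope.

(** * Submodules, quotients and free modules *)

Section LinearAlgebra.
Variable R : pzRingType.
Implicit Types U V M : lmodType R.

(** Classical truth values turn a propositional predicate into the boolean one that [submodClosed]
    asks for. *)
Lemma ex_submodClosed V (P : V -> Prop) :
    P 0 -> (forall a x y, P x -> P y -> P (a *: x + y)) ->
  exists N : submodClosed V, forall x, x \in N <-> P x.
Proof.
move=> P0 PZD; pose p : pred V := fun x => `[< P x >].
have p_closed : GRing.subsemimod_closed p.
  split; first split; first exact/asboolP.
    by move=> x y /asboolP Px /asboolP Py; rewrite -[x]scale1r; exact/asboolP/PZD.
  by move=> a x /asboolP Px; rewrite -[a *: x]addr0; exact/asboolP/PZD.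
pose pB := GRing.isSubmodClosed.Build R V p p_closed.
pose N : submodClosed V := HB.pack p pB.
by exists N => x; split => /asboolP.
Qed.

Lemma ex_linear U V (f : U -> V) : linear f -> exists h : {linear U -> V}, h =1 f.
Proof.
move=> f_lin; pose fB := GRing.isLinear.Build R U V _ f f_lin.
by pose h : {linear U -> V} := HB.pack f fB; exists h.
Qed.

Lemma ex_mul_linear V (v : V) : exists h : {linear R^o -> V}, forall a : R, h a = a *: v.
Proof. by apply: ex_linear => a x y; rewrite scalerDl scalerA. Qed.

Lemma projective_ring : projective (R^o : lmodType R).
Proof.
move=> M N g f g_surj; have [m gm] := g_surj (f 1).
have [h hE] := ex_mul_linear m; exists h => a /=.
by rewrite hE linearZ gm -linearZ /= -[a in RHS]mulr1.
Qed.

End LinearAlgebra.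

Section Quotient.
Variables (R : pzRingType) (V : lmodType R) (N : submodClosed V).

Let zmodN : GRing.zmod_closed (mem N).
Proof.
split=> [|x y xN yN]; first exact: rpred0.
by apply: rpredD => //; rewrite -scaleN1r; exact: rpredZ.
Qed.

Let zN : zmodClosed V :=
  HB.pack (mem N : {pred V}) (GRing.isZmodClosed.Build V (mem N) zmodN).

Definition quotient_module : Type := Quotient.quot zN.
HB.instance Definition _ := GRing.Zmodule.on quotient_module.

Let proj (x : V) : quotient_module := \pi_(Quotient.quot zN) x.
(** The action is computed on a chosen representative; [scale_proj] shows that the choice is
    immaterial, because [N] is stable under scalars. *)
Let scale (a : R) (q : quotient_module) : quotient_module :=
  proj (a *: repr (q : Quotient.quot zN)).

Let mod_eq x y : (x - y \in N) = (x == y %[mod Quotient.quot zN]).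
Proof. exact: (Quotient.idealrBE zN x y). Qed.

Let projP x y : x - y \in N -> proj x = proj y.
Proof. by move=> xy; apply/eqP; rewrite -mod_eq. Qed.

Let scale_proj a x : scale a (proj x) = proj (a *: x).
Proof.
apply: projP; rewrite -scalerBr; apply: rpredZ.
by rewrite mod_eq reprK.
Qed.

Let proj_ind (P : quotient_module -> Prop) : (forall x, P (proj x)) -> forall q, P q.
Proof. by move=> Pproj q; rewrite -[q](@reprK _ (Quotient.quot zN)). Qed.

Let projD x y : proj (x + y) = proj x + proj y.
Proof. by rewrite /proj raddfD. Qed.

Let scaleA a b q : scale a (scale b q) = scale (a * b) q.
Proof. by elim/proj_ind: q => x; rewrite !scale_proj scalerA. Qed.

Let scale1 q : scale 1 q = q.
Proof. by elim/proj_ind: q => x; rewrite scale_proj scale1r. Qed.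

Let scaleDr a q1 q2 : scale a (q1 + q2) = scale a q1 + scale a q2.
Proof.
elim/proj_ind: q1 => x; elim/proj_ind: q2 => y.
by rewrite -projD !scale_proj scalerDr projD.
Qed.

Let scaleDl q a b : scale (a + b) q = scale a q + scale b q.
Proof. by elim/proj_ind: q => x; rewrite !scale_proj scalerDl projD. Qed.

HB.instance Definition _ :=
  GRing.Zmodule_isLmodule.Build R quotient_module scaleA scale1 scaleDr scaleDl.

Lemma ex_cokernel : exists (Q : lmodType R) (p : {linear V -> Q}),
  forall x, p x = 0 <-> x \in N.
Proof.
have [|p pE] := @ex_linear R V quotient_module proj.
  by move=> a x y; rewrite projD -scale_proj.
exists quotient_module, p => x.
rewrite pE -[x in x \in _]subr0 mod_eq.
have -> : (0 : quotient_module) = proj 0 by rewrite /proj raddf0.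
by split=> [/eqP|/eqP].
Qed.

End Quotient.

Section FreeModule.
Variables (R : pzRingType) (V : lmodType R).

Definition supported_in (s : seq V) (c : V -> R^o) : Prop :=
  forall v, v \notin s -> c v = 0.

(** Both sums agree with the one over [undup (s ++ t)], whose extra terms have coefficient zero. *)
Lemma sum_supported_in (s t : seq V) (c : V -> R^o) :
    uniq s -> uniq t -> supported_in s c -> supported_in t c ->
  \sum_(v <- s) (c v : R) *: v = \sum_(v <- t) (c v : R) *: v.
Proof.
suff step (s' : seq V) : uniq s' -> supported_in s' c -> forall t' : seq V,
    uniq t' -> {subset s' <= t'} ->
    \sum_(v <- s') (c v : R) *: v = \sum_(v <- t') (c v : R) *: v.
  move=> us ut cs ct; have uu := undup_uniq (s ++ t).
  by rewrite (step s us cs _ uu) ?(step t ut ct _ uu) // => v vs;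
    rewrite mem_undup mem_cat vs ?orbT.
move=> us cs t' ut st.
rewrite [RHS](bigID (mem s')) /= [X in _ + X]big1 ?addr0; last first.
  by move=> v /cs ->; rewrite scale0r.
rewrite -[RHS]big_filter; apply: perm_big; apply: uniq_perm => //.
  exact: filter_uniq.
by move=> v; rewrite mem_filter; case: (boolP (v \in s')) => // /st ->.
Qed.

(** [F] is the free module on the underlying set of [V], realized as the finitely supported
    functions; [p] evaluates formal combinations and [coord v] reads off the coefficient at [v]. *)
Lemma ex_free_cover : exists (F : lmodType R) (p : {linear F -> V})
    (coord : V -> {linear F -> R^o}), surjective p /\
  forall x, exists s : seq V, p x = \sum_(v <- s) (coord v x : R) *: v.
Proof.
have [| |N NP] := @ex_submodClosed R (V -> R^o)
  (fun c => exists s, supported_in s c).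
- by exists [::].
- move=> a c d [s cs] [t dt]; exists (s ++ t) => v.
  rewrite mem_cat negb_or => /andP[/cs cv /dt dv].
  have -> : (a *: c + d) v = a * c v + d v by [].
  by rewrite cv dv mulr0 addr0.
have supp (c : submodule N) : {s : seq V | uniq s & supported_in s (val c)}.
  have /cid[s cs] := (NP (val c)).1 (valP c).
  by exists (undup s); rewrite ?undup_uniq // => v; rewrite mem_undup => /cs.
pose ev (c : submodule N) := \sum_(v <- s2val (supp c)) (val c v : R) *: v.
have evE (c : submodule N) s : uniq s -> supported_in s (val c) ->
    ev c = \sum_(v <- s) (val c v : R) *: v.
  move=> us cs; rewrite /ev; case: (supp c) => t ut ct /=; exact: sum_supported_in.
have [p pE] : exists p : {linear submodule N -> V}, p =1 ev.
  apply: ex_linear => a c d.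
  case: (supp c) (supp d) => s us cs [t ut dt].
  have uu := undup_uniq (s ++ t).
  have sub e : supported_in s e \/ supported_in t e -> supported_in (undup (s ++ t)) e.
    move=> st v; rewrite mem_undup mem_cat negb_or => /andP[vs vt].
    by case: st => [/(_ v vs)|/(_ v vt)].
  have cu := sub _ (or_introl cs); have du := sub _ (or_intror dt).
  rewrite !(evE _ (undup (s ++ t))) //; last first.
    move=> v vst; have -> : val (a *: c + d) v = a * val c v + val d v by [].
    by rewrite cu // du // mulr0 addr0.
  rewrite scaler_sumr -big_split; apply: eq_bigr => v _ /=.
  by rewrite scalerA -scalerDl.
have coordP v : exists h : {linear submodule N -> R^o}, forall c, h c = val c v.
  exact: ex_linear.
exists (submodule N), p, (fun v => sval (cid (coordP v))); split.
  (* The basis vector at [v] is a preimage of [v]. *)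
  move=> v; have dN : (fun w => if w == v then 1 else 0 : R^o) \in N.
    by apply/NP; exists [:: v] => w; rewrite inE => /negbTE ->.
  exists (exist (fun c => c \in N) _ dN); rewrite pE.
  rewrite (evE _ [:: v]) //= ?big_seq1 ?eqxx ?scale1r //.
  by move=> w; rewrite inE /= => /negbTE ->.
move=> c; exists (s2val (supp c)); rewrite pE.
by apply: eq_bigr => v _; case: cid => h /= ->.
Qed.

End FreeModule.

(** * Idempotents and semisimplicity *)

Local Open Scope classical_set_scope.

Section SemisimpleRings.
Variable R : pzRingType.

(** The free cover of [P] splits; the coordinates are pulled back along a section [h]. *)
Lemma projective_dual_basis (P : lmodType R) : projective P ->
  exists coord : P -> {linear P -> R^o},
  forall x, exists s : seq P, x = \sum_(v <- s) (coord v x : R) *: v.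
Proof.
move=> P_proj; have [F [p [coord [p_surj pE]]]] := ex_free_cover P.
have [h hK] := P_proj _ _ p idfun p_surj.
exists (fun v => coord v \o h) => x.
by have [s sE] := pE (h x); exists s; rewrite -sE; exact/esym/hK.
Qed.

(* The sequence [0 -> ann c -> R -> R c -> 0] splits because [R c] is projective. *)
Lemma left_hereditary_annihilator (c : R) : left_hereditary R ->
  exists t : R, t * c = c /\ forall b, b * c = 0 -> b * t = 0.
Proof.
move=> R_her.
have [| |N NP] := @ex_submodClosed R R^o (fun y : R => exists b, y = b * c).
- by exists 0; rewrite mul0r.
- move=> a _ _ [x ->] [y ->]; exists (a * x + y).
  by rewrite mulrDl -mulrA.
have mulcN (b : R) : (b * c : R^o) \in N by apply/NP; exists b.
pose m (b : R^o) : submodule N := exist (fun y => y \in N) _ (mulcN b).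
have [|p pE] := @ex_linear R _ _ m.
  by move=> a x y; apply: val_inj; rewrite /= mulrDl -mulrA.
have p_surj : surjective p.
  move=> [y yN]; have /NP[b yE] := yN; exists b.
  by rewrite pE; apply: val_inj; rewrite /= yE.
have [h hK] := R_her N _ _ p idfun p_surj.
have pZ (b : R) : p b = b *: p 1 by rewrite -linearZ /= [X in _ = p X]mulr1.
(* With [p] the map [b |-> b * c] onto [R c] and [h] a section of it, [t] is the value of [h] at
   [c], so that [b * t = h (b * c)]. *)
exists (h (p 1)); split.
  have := congr1 val (hK (p 1)); rewrite /=; move: (h (p 1)) => t.
  by rewrite !pE /= mul1r.
move=> b bc; have -> : b * h (p 1) = h (p b) by rewrite [p b]pZ linearZ.
have -> : p b = 0 by apply: val_inj; rewrite pE.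
exact: linear0.
Qed.

Lemma left_hereditary_annihilator_seq (s : seq R) : left_hereditary R ->
  exists e : R, {in s, forall a, e * a = 0} /\
    forall b, {in s, forall a, b * a = 0} -> b * e = b.
Proof.
move=> R_her; elim: s => [|a s [e [es e_id]]].
  by exists 1; split=> // b _; rewrite mulr1.
have [t [tea t0]] := left_hereditary_annihilator (e * a) R_her.
(* This is [(1 - t) * e]. It kills [a] as [t] fixes [e * a]; if [b] kills [a] and [s], then
   [b * e = b], so [b] kills [e * a] and [b * t = 0]. *)
exists (e - t * e); split.
  move=> x; rewrite inE mulrBl -mulrA => /predU1P[->|/es ->].
    by rewrite tea subrr.
  by rewrite mulr0 subrr.
move=> b b0; have be : b * e = b by apply: e_id => x xs; rewrite b0 // inE xs orbT.
rewrite mulrBr be mulrA t0 ?mul0r ?subr0 // mulrA be.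
by apply: b0; rewrite inE eqxx.
Qed.

(** A scalar kills [x] exactly when it kills the finitely many coordinates [cs] from which [x] is
    rebuilt. *)
Lemma left_hereditary_projective_annihilator (P : lmodType R) (x : P) :
    left_hereditary R -> projective P ->
  exists e : R, e *: x = 0 /\ forall b : R, b *: x = 0 -> b * e = b.
Proof.
move=> R_her P_proj; have [coord xE] := projective_dual_basis P_proj.
have [s sE] := xE x.
pose cs := [seq (coord v x : R) | v <- s].
have [e [es e_id]] := left_hereditary_annihilator_seq cs R_her.
exists e; split.
  rewrite sE scaler_sumr big_seq big1 // => v vs.
  by rewrite scalerA es ?scale0r //; apply: map_f.
move=> b bx; apply: e_id => _ /mapP[v _ ->].
have -> : b * coord v x = coord v (b *: x) by rewrite linearZ.
by rewrite bx linear0.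
Qed.

(** A maximal [A] meeting [N] trivially is a complement: if [x] were outside [S = N + A], the
    idempotent generating the ideal of all [a] with [a *: x] in [S] would yield a multiple of [x] by
    which [A] can be enlarged. *)
Lemma semisimple_ring_of_idempotents :
    (forall I : submodClosed R^o, exists e : R, (e : R^o) \in I /\
      forall b, (b : R^o) \in I -> b * e = b) ->
  semisimple_ring R.
Proof.
move=> idem M N.
(* [0] is not required to belong to [A], so that the empty chain has a bound. *)
pose indep (A : set M) := (forall a : R, forall x y, A x -> A y -> A (a *: x + y)) /\
  forall x, A x -> x \in N -> x = 0.
have [F indF totF|A [[A_lin A_ind] A_max]] := @Zorn_bigcup M indep.
  split=> [a x y [X FX Xx] [Y FY Yy]|x [X FX Xx]]; last exact: (indF X FX).2.
  have [XY|YX] := totF _ _ FX FY.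
    by exists Y => //; apply: (indF Y FY).1 => //; exact: XY.
  by exists X => //; apply: (indF X FX).1 => //; exact: YX.
(* Linear closure puts [0] in any nonempty [A], and an empty [A] would be strictly below
   [[set 0]]. *)
have A0 : A 0.
  apply: contrapT => nA0; apply: (A_max [set 0]).
    split=> [x Ax|/(_ 0 erefl) //].
    by exfalso; apply: nA0; rewrite -(addNr x) -scaleN1r; exact: A_lin.
  by split=> [a x y -> ->|x -> //]; rewrite scaler0 addr0.
have [| |N' N'P] := @ex_submodClosed R M A => //.
exists N'; split=> [x xN /N'P Ax|]; first exact: A_ind.
have [| |S SP] := @ex_submodClosed R M
  (fun x => exists y z, [/\ y \in N, z \in N' & x = y + z]).
- by exists 0, 0; rewrite !rpred0 addr0.
- move=> a _ _ [x [x' [xN xN' ->]]] [y [y' [yN yN' ->]]].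
  exists (a *: x + y), (a *: x' + y').
  split; [exact/rpredD/yN/rpredZ | exact/rpredD/yN'/rpredZ |].
  by rewrite scalerDr addrACA.
suff SM x : x \in S by move=> x; exact/SP.
apply: contrapT => xS.
have [| |I IP] := @ex_submodClosed R R^o (fun a : R => a *: x \in S).
- by rewrite scale0r rpred0.
- by move=> a b c bS cS; rewrite scalerDl -scalerA; apply/rpredD/cS/rpredZ.
have [e [eI e_id]] := idem I.
have /IP exS := eI.
(* [R y] meets [S] trivially, so [A + R y] contradicts the maximality of [A]. *)
pose y := (1 - e) *: x.
have yS : y \notin S.
  apply/negP => yS; apply: xS; rewrite -[x]scale1r -(subrK e 1) scalerDl.
  exact: rpredD.
have ann (a : R) : a *: y \in S -> a *: y = 0.
  rewrite scalerA => aS; have /IP aI := aS.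
  rewrite -(e_id _ aI) -mulrA mulrBl mul1r.
  have -> : e * e = e by exact: e_id.
  by rewrite subrr mulr0 scale0r.
have NS z : z \in N -> z \in S.
  by move=> zN; apply/SP; exists z, 0; rewrite addr0 rpred0.
have N'S z : z \in N' -> z \in S.
  by move=> zN; apply/SP; exists 0, z; rewrite add0r rpred0.
apply: (A_max [set z | exists n a, A n /\ z = n + a *: y]).
  split=> [n An|/(_ y)]; first by exists n, 0; rewrite scale0r addr0.
  have By : exists n a, A n /\ y = n + a *: y by exists 0, 1; rewrite scale1r add0r.
  by move=> /(_ By) /N'P/N'S; rewrite (negbTE yS).
split.
  move=> a _ _ [n [b [An ->]]] [m [c [Am ->]]].
  exists (a *: n + m), (a * b + c); split; first exact: A_lin.
  by rewrite scalerDr scalerDl scalerA addrACA.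
move=> _ [n [a [An ->]]] nyN.
(* Both [n + a *: y] and [n] lie in [S], hence so does [a *: y]. *)
have ay : a *: y = 0.
  apply: ann; rewrite -[a *: y](addKr n) addrC.
  apply: rpredD; first exact: NS.
  by rewrite -scaleN1r; apply/rpredZ/N'S/N'P.
by move: nyN; rewrite ay addr0; exact: A_ind.
Qed.

(** A complement [L] of the kernel of [g] is mapped bijectively onto the target, and [f] lifts
    through the inverse. *)
Lemma semisimple_ring_projective (P : lmodType R) : semisimple_ring R -> projective P.
Proof.
move=> R_ss M N g f g_surj.
have [| |K KP] := @ex_submodClosed R M (fun x => g x = 0).
- exact: linear0.
- by move=> a x y gx gy; rewrite linearP gx gy scaler0 addr0.
have [L [KL_disj KL_sum]] := R_ss M K.
have section z : exists m, m \in L /\ g m = z.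
  have [m gm] := g_surj z; have [k [l [/KP gk lL mE]]] := KL_sum m.
  by exists l; split=> //; rewrite -gm mE linearD gk add0r.
have L_inj x y : x \in L -> y \in L -> g x = g y -> x = y.
  move=> xL yL gxy; apply/subr0_eq/KL_disj.
    by apply/KP; rewrite linearB gxy subrr.
  by apply: rpredD => //; rewrite -scaleN1r; exact: rpredZ.
(* The preimages are merely chosen; linearity of [s \o f] follows from injectivity of [g] on [L]. *)
have /choice[s sP] := section.
have [|h hE] := @ex_linear R P M (s \o f).
  move=> a x y; apply: L_inj; first exact: (sP _).1.
    by apply: rpredD; [apply: rpredZ|]; exact: (sP _).1.
  by rewrite linearP !(sP _).2 linearP.
by exists h => x /=; rewrite hE (sP _).2.
Qed.

End SemisimpleRings.

Local Close Scope classical_set_scope.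

(** * Reflective subcategories *)

Lemma finite_type_finType (T : finType) : finite_type T.
Proof. by exists #|T|, enum_val => x; exists (enum_rank x); rewrite enum_rankK. Qed.

(** * Equalizers as limits over the parallel pair *)

Section Equalizers.

(** The object [false] is the source and [true] the target; the two parallel arrows are the
    booleans. *)
Definition parallel_hom (i j : bool) : Type :=
  match i, j with
  | false, true => bool
  | true, false => void
  | _, _ => unit
  end.

Definition parallel_id (i : bool) : parallel_hom i i :=
  if i is true then tt else tt.

Definition parallel_comp (i j k : bool) :
    parallel_hom j k -> parallel_hom i j -> parallel_hom i k :=
  match i, j, k with
  | false, false, false => fun _ _ => tt
  | false, false, true => fun s _ => s
  | false, true, true => fun _ s => s
  | false, true, false => fun s _ => match s with end
  | true, false, _ => fun _ s => match s with end
  | true, true, true => fun _ _ => tt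
  | true, true, false => fun s _ => match s with end
  end.

Definition parallel_pair : category.
Proof.
refine (@Category bool parallel_hom parallel_id parallel_comp _ _ _).
- by move=> [] [] // [].
- by move=> [] [] // [].
- by move=> [] [] [] [] // h g f; case: f; case: g; case: h.
Defined.

Lemma finite_parallel_pair : finite_category parallel_pair.
Proof.
split; first exact: (finite_type_finType bool).
move=> [] []; first [exact: (finite_type_finType unit)
  | exact: (finite_type_finType void) | exact: (finite_type_finType bool)].
Qed.

Variables (C : category) (a b : C) (f g : hom a b).

Definition parallel_obj (i : parallel_pair) : C := if i is true then b else a.

Definition parallel_map (i j : parallel_pair) :
    hom i j -> hom (parallel_obj i) (parallel_obj j) :=
  match i, j with
  | false, false => fun _ => idm a
  | true, true => fun _ => idm b
  | false, true => fun s => if s then f else g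
  | true, false => fun s => match s with end
  end.

Definition parallel_diagram : functor parallel_pair C.
Proof.
refine (@Functor parallel_pair C parallel_obj parallel_map _ _).
- by case.
- move=> [] [] [] //= t s; rewrite ?comp_idl ?comp_idr //; by [case: s | case: t].
Defined.

Definition is_equalizer (k : C) (h : hom k a) : Prop :=
  comp f h = comp g h /\
  forall (c : C) (z : hom c a), comp f z = comp g z -> exists! u, comp h u = z.

Definition fork_leg (k : C) (h : hom k a) (j : parallel_pair) :
    hom k (parallel_diagram j) :=
  match j with false => h | true => comp f h end.

Lemma fork_leg_natural (k : C) (h : hom k a) : comp f h = comp g h ->
  forall (i j : parallel_pair) (s : hom i j),
    comp (fmap parallel_diagram s) (fork_leg h i) = fork_leg h j.
Proof. by move=> fgh [] [] [] //=; rewrite ?comp_idl. Qed.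

Definition fork_cone (k : C) (h : hom k a) (fgh : comp f h = comp g h) :
  cone parallel_diagram := Cone (fork_leg_natural fgh).

(** A cone over the diagram amounts to its leg at [false]: naturality along the two arrows says that
    this leg equalizes [f] and [g], and determines the leg at [true]. *)
Lemma fork_cone_limit (k : C) (h : hom k a) (fgh : comp f h = comp g h) :
  is_equalizer h -> is_limit (fork_cone fgh).
Proof.
move=> [_ h_univ] c'.
pose z : hom (apex c') a := leg c' (false : parallel_pair).
have fz : comp f z = leg c' (true : parallel_pair).
  exact: (@leg_natural _ _ _ c' (false : parallel_pair) (true : parallel_pair) true).
have gz : comp g z = leg c' (true : parallel_pair).
  exact: (@leg_natural _ _ _ c' (false : parallel_pair) (true : parallel_pair) false).
have [|u [hu u_uniq]] := h_univ _ z; first by rewrite fz gz.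
exists u; split=> [[]|v hv] /=; last exact/u_uniq/(hv false).
- by rewrite -comp_assoc hu fz.
- exact: hu.
Qed.

End Equalizers.

(** * The unit of a reflection and left exactness *)

Section Reflection.
Variables (C : category) (P : C -> Prop) (r : functor C (full_subcategory P)).
Variable adj : adjunction r (inclusion P).

Definition unit a : hom a (sval (r a)) := transpose adj (idm (r a)).

(** Both sides are the transpose of [fmap r f]. *)
Lemma unit_natural a b (f : hom a b) :
  comp (fmap r f : hom (sval (r a)) (sval (r b))) (unit a) = comp (unit b) f.
Proof.
have := transpose_natr adj (fmap r f) (idm (r a)).
by have := transpose_natl adj f (idm (r b)); rewrite comp_idl comp_idr => -> ->.
Qed.

Lemma unit_iso a : P a -> exists e : hom (sval (r a)) a,
  comp e (unit a) = idm a /\ comp (unit a) e = idm (sval (r a)).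
Proof.
move=> Pa; pose a' : full_subcategory P := exist _ a Pa.
have [untr trK untrK] := transpose_bij adj a a'.
(* The inverse is the counit at [a']; [unit a] is itself a map of the subcategory by fullness, so
   [comp (unit a) e] can be transposed and compared with the identity. *)
pose e : hom (r a) a' := untr (idm a).
have te : transpose adj e = idm a by exact: untrK.
exists e; split.
  by have := transpose_natr adj e (idm (r a)); rewrite comp_idr te => ->.
have := transpose_natr adj (unit a : hom a' (r a)) e.
rewrite te comp_idr => tr.
exact: (bij_inj (transpose_bij adj a (r a)) tr).
Qed.

Lemma left_exact_reflector_total : (forall a, P a) -> left_exact r.
Proof.
move=> Ptot J K c _ c_lim c'.
have /cid2-[e e_unit unit_e] : exists2 e : forall a, hom (sval (r a)) a,
    forall a, comp (e a) (unit a) = idm a &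
    forall a, comp (unit a) (e a) = idm (sval (r a)).
  exists (fun a => sval (cid (unit_iso (Ptot a)))) => a;
    by case: cid => ? [].
have e_natural a b (f : hom a b) :
    comp (e b) (fmap r f : hom (sval (r a)) (sval (r b))) = comp f (e a).
  rewrite -[X in comp _ X = _](@comp_idr C) -unit_e.
  rewrite [comp _ (comp (unit a) _)]comp_assoc unit_natural.
  by rewrite !comp_assoc e_unit comp_idl.
(* The natural isomorphism [e] carries the cone [c'] over the image of [K] to a cone over [K]
   itself. *)
pose l (j : J) : hom (sval (apex c')) (K j) := comp (e (K j)) (leg c' j).
have l_nat (i j : J) (s : hom i j) : comp (fmap K s) (l i) = l j.
  rewrite /l comp_assoc -e_natural -comp_assoc; congr (comp _ _).
  exact: (leg_natural c' s).
have [u [uE u_uniq]] := c_lim (Cone l_nat).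
exists (comp (unit _) u : hom (apex c') (r (apex c))); split=> [j|v vE].
  have -> : leg c' j = comp (unit (K j)) (l j).
    by rewrite /l comp_assoc unit_e comp_idl.
  rewrite -[l j]uE [RHS]comp_assoc -[comp (unit (K j)) _]unit_natural.
  exact: (@comp_assoc C).
have -> : u = comp (e (apex c)) v.
  apply: u_uniq => j; rewrite comp_assoc -e_natural -comp_assoc.
  by congr (comp _ _); exact: (vE j).
by rewrite comp_assoc unit_e comp_idl.
Qed.

(** The map [comp (unit a) z] equalizes the images of [f] and [g], hence factors through that of
    [h]; inverting the unit at [k] and [a] makes [z] factor through [h]. This serves to show that
    the unit at [b] is injective. *)
Lemma left_exact_reflector_equalizer (k a b c : C) (f g : hom a b) (h : hom k a)
    (z : hom c a) :
    left_exact r -> is_equalizer f g h -> P k -> P a -> P c ->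
    comp (unit b) (comp f z) = comp (unit b) (comp g z) ->
  comp f z = comp g z.
Proof.
move=> r_lex h_eq Pk Pa Pc fgz; have [fgh _] := h_eq.
have r_lim := r_lex _ _ _ finite_parallel_pair (fork_cone_limit fgh h_eq).
pose c' : full_subcategory P := exist _ c Pc.
pose w : hom c' (r a) := comp (unit a) z.
have w_fork : comp (fmap r f) w = comp (fmap r g) w.
  have wE (d : hom a b) : comp (fmap r d) w = comp (unit b) (comp d z).
    by rewrite [RHS]comp_assoc -unit_natural; exact: (@comp_assoc C).
  by rewrite !wE.
pose l (j : parallel_pair) : hom c' (comp_functor r (parallel_diagram f g) j) :=
  match j with false => w | true => comp (fmap r f) w end.
have l_nat (i j : parallel_pair) (s : hom i j) :
    comp (fmap (comp_functor r (parallel_diagram f g)) s) (l i) = l j.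
  case: i j s => [] [] [] //=.
  - by rewrite (fmap_id r b); exact: (@comp_idl C).
  - by rewrite (fmap_id r a); exact: (@comp_idl C).
have [u [uE _]] := r_lim (Cone l_nat).
have [ek [_ unit_ek]] := unit_iso Pk.
have [ea [ea_unit _]] := unit_iso Pa.
have zE : z = comp h (comp ek u).
  have hu : comp (fmap r h : hom (sval (r k)) (sval (r a))) u = comp (unit a) z
    := uE false.
  have /(congr1 (comp ea)) := hu.
  rewrite [RHS]comp_assoc ea_unit comp_idl => <-.
  rewrite -[X in comp _ (comp _ X) = _](@comp_idl C) -unit_ek.
  rewrite -[comp (comp (unit k) ek) u]comp_assoc.
  rewrite [comp _ (comp (unit k) _)]comp_assoc unit_natural.
  by rewrite !comp_assoc ea_unit comp_idl.
by rewrite zE !comp_assoc fgh.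
Qed.

End Reflection.

(** * Reflectors on projective modules *)

Lemma left_exact_reflector_semisimple (R : pzRingType)
    (r : functor (module_category R) (projective_category R))
    (adj : adjunction r (projective_inclusion R)) :
  left_hereditary R -> left_exact r -> semisimple_ring R.
Proof.
move=> R_her r_lex; apply: semisimple_ring_of_idempotents => I.
have [Q [p pP]] := ex_cokernel I.
have [i iE] : exists i : {linear submodule I -> R^o}, i =1 val by exact: ex_linear.
pose zero : {linear R^o -> Q} := \0.
have i_eq : @is_equalizer (module_category R) _ _ p zero _ i.
  split; first by apply: linear_ext => x /=; rewrite iE; apply/pP/valP.
  move=> W w pw.
  have wI x : w x \in I.
    by apply/pP; exact: (congr1 (fun h : {linear W -> Q} => h x) pw).
  have [|u uE] := @ex_linear R W (submodule I)
    (fun x => exist (fun y => y \in I) _ (wI x)).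
    by move=> a x y; apply: val_inj; rewrite /= linearP.
  exists u; split=> [|v vE]; apply: linear_ext => x /=; first by rewrite iE uE.
  apply: val_inj; rewrite uE /= -iE.
  exact/esym/(congr1 (fun h : {linear W -> R^o} => h x) vE).
pose eta : {linear Q -> sval (r Q)} := unit adj Q.
have eta_p (b : R) : eta (p b) = 0 -> (b : R^o) \in I.
  (* The element [b] is encoded as the map [z] from [R] sending [1] to [b], to which the
     cancellation for equalizers applies. *)
  move=> pb; have [z zE] := ex_mul_linear (b : R^o).
  have pz_eq : p \o z = zero \o z :> {linear R^o -> Q}.
    apply: (left_exact_reflector_equalizer (adj := adj) r_lex i_eq (R_her I)).
    - exact: projective_ring.
    - exact: projective_ring.
    apply: linear_ext => a /=; rewrite zE !linearZ linear0 /=.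
    by rewrite [X in _ *: X]pb scaler0.
  apply/pP; have := congr1 (fun h : {linear R^o -> Q} => h 1) pz_eq.
  by rewrite /= zE scale1r.
(* By [eta_p], the ideal [I] is the annihilator of [eta (p 1)], an element of the projective module
   [r Q]. *)
have [e [e0 e_id]] :=
  left_hereditary_projective_annihilator (eta (p 1)) R_her (svalP (r Q)).
have etaE (b : R) : b *: eta (p 1) = eta (p b).
  by rewrite -!linearZ; congr (eta (p _)); exact: mulr1.
exists e; split; first by apply: eta_p; rewrite -etaE.
move=> b bI; apply: e_id; rewrite etaE.
by have /pP -> := bI; rewrite linear0.
Qed.

Theorem proposition3p6 (R : pzRingType) (hereditaryR : left_hereditary R)
    (perfectR : left_perfect R) (coherentR : right_coherent R)
    (r : functor (module_category R) (projective_category R))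
    (r_reflector : adjunction r (projective_inclusion R)) :
  left_exact r <-> semisimple_ring R.
Proof.
split; first exact: left_exact_reflector_semisimple.
move=> R_ss; apply: (left_exact_reflector_total r_reflector) => M.
exact: semisimple_ring_projective.
Qed.
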